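(* Let $S$ be a semigroup with zero and let $x,y\in \mathrm{Nil}(S)\setminus\{0\}$ with $x\neq y$. Then $\overrightarrow{d}(x,y)\leq 2$ in the zero-divisor digraph $\overrightarrow{\Gamma}(S)$.
   Context: Let $S$ be a semigroup with zero, not necessarily commutative; for $A\subseteq S$, $A^{*}=A\setminus\{0\}$. An element $x\in S$ is a left (resp. right) zero divisor if $xy=0$ (resp. $yx=0$) for some $y\in S^{*}$; $Z(S)$ is the set of all elements that are left or right zero divisors. $\mathrm{Nil}(S)$ is the set of nilpotent elements of $S$ (those $x$ with $x^{n}=0$ for some positive integer $n$). The zero-divisor digraph $\overrightarrow{\Gamma}(S)$ is the simple digraph (no loops, no multiple arcs) with vertex set $Z(S)^{*}$ in which, for distinct $x,y\in Z(S)^{*}$, $x\to y$ is an arc if and only if $xy=0$. The directed distance $\overrightarrow{d}(x,y)$ is the length (number of arcs) of a shortest directed path from $x$ to $y$, and $\infty$ if there is none. *)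

(* Defs.v *)
From HB Require Import structures.
From mathcomp Require Import all_boot all_order all_algebra.
From mathcomp Require Import boolp classical_sets constructive_ereal.

Set Implicit Arguments.
Unset Strict Implicit.
Unset Printing Implicit Defensive.

Local Open Scope group_scope.
Local Open Scope classical_set_scope.

(* [semigroupType] includes a choice structure on the carrier; this is no
   restriction classically, see [{classic T}] in [boolp]. *)
HB.mixin Record Semigroup_hasZero S of Semigroup S := {
  szero : S;
  smul0s : left_zero szero (@monoid.mul S);
  smuls0 : right_zero szero (@monoid.mul S)
}.

#[short(type="semigroup0Type")]
HB.structure Definition Semigroup0 := {S of Semigroup_hasZero S & Semigroup S}.

Arguments szero {s}.

Section ZeroDivisors.
Variable S : semigroup0Type.
Implicit Types x y : S.

(* [natexp] requires a unit; here the value at [n = 0] is irrelevant. *)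
Definition sexp x (n : nat) : S := iterop n *%g x x.

Definition nilpotents : set S := [set x | exists2 n, (0 < n)%N & sexp x n = szero].

Definition left_zero_divisor x := exists2 y, y != szero & x * y = szero.

Definition right_zero_divisor x := exists2 y, y != szero & y * x = szero.

Definition zero_divisors : set S :=
  [set x | left_zero_divisor x \/ right_zero_divisor x].

End ZeroDivisors.

Arguments nilpotents : clear implicits.
Arguments zero_divisors : clear implicits.

Record digraph (T : eqType) := Digraph {
  vertices : set T;
  arc : rel T;
  arc_vertices : forall x y, arc x y -> vertices x /\ vertices y;
  arc_irr : irreflexive arc
}.

Section Distance.
Variables (T : eqType) (G : digraph T).
Implicit Types (x y : T) (p : seq T).

(* The vertices of the path are those of [x :: p], so it has [size p] arcs. *)
Definition is_dipath x y p :=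
  [/\ vertices G x, path (arc G) x p, last x p = y & uniq (x :: p)].

Definition has_dipath x y : pred nat :=
  fun n => `[< exists2 p, is_dipath x y p & size p = n >].

Definition ddist x y : \bar int :=
  if pselect (exists n, has_dipath x y n) is left ex then (ex_minn ex)%:Z%:E
  else +oo%E.

End Distance.

Section ZeroDivisorDigraph.
Variable S : semigroup0Type.

Definition zd_arc : rel S := fun x y =>
  [&& x \in zero_divisors S `\ szero, y \in zero_divisors S `\ szero, x != y & x * y == szero].

Lemma zd_arc_vertices x y :
  zd_arc x y -> (zero_divisors S `\ szero) x /\ (zero_divisors S `\ szero) y.
Proof. by case/and4P => /set_mem xZ /set_mem yZ _ _. Qed.

Lemma zd_arc_irr : irreflexive zd_arc.
Proof. by move=> x; rewrite /zd_arc eqxx /= !andbF. Qed.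

Definition zero_divisor_digraph : digraph S :=
  Digraph zd_arc_vertices zd_arc_irr.

End ZeroDivisorDigraph.

Arguments zero_divisor_digraph : clear implicits.

(* Main.v *)
Require Import Defs.
From mathcomp Require Import all_boot all_order all_algebra.
From mathcomp Require Import boolp classical_sets constructive_ereal.

(** Multiplying a nonzero element repeatedly by a nilpotent [x] must eventually
    give [szero], so the last nonzero value is annihilated by [x].  Applied to
    [y] with left factors [x], this gives [w = x ^ i * y <> szero] with
    [x * w = szero]; applied to [w] with right factors [y], it gives
    [z = x ^ i * y * y ^ j <> szero] with [z * y = szero], and [x * z = szero]
    survives since [z] is a right multiple of [w].  If [x], [z], [y] are
    distinct, then [x -> z -> y] is a path.  If [z] is [x] or [y], then one of
    the two products says [x * y = szero], and [x -> y] is an arc.  The exponents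
    [i] and [j] may be [0], so the case [x * y = szero] is included. *)

Set Implicit Arguments.
Unset Strict Implicit.
Unset Printing Implicit Defensive.

Local Open Scope group_scope.

Lemma ddist_le_size (T : eqType) (G : digraph T) (x y : T) p :
  is_dipath G x y p -> (ddist G x y <= (size p)%:Z%:E)%E.
Proof.
move=> xyp; have xy_size : has_dipath G x y (size p) by apply/asboolP; exists p.
rewrite /ddist; case: pselect => [ex|[]]; last by exists (size p).
by case: ex_minnP => n _ /(_ _ xy_size); rewrite lee_fin.
Qed.

(** The step just before the first time the iteration reaches [b]; for [f] a
    multiplication and [b] the zero, it turns nilpotency into annihilation. *)
Lemma iter_last_neq (T : eqType) (f : T -> T) (a b : T) n :
  a != b -> iter n f a = b -> exists2 i, iter i f a != b & iter i.+1 f a = b.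
Proof.
move=> a_neq_b; elim: n => [/eqP|n IHn fab]; first by rewrite (negPf a_neq_b).
by have [/IHn|fa_neq_b] := eqVneq (iter n f a) b; last by exists n.
Qed.

Section Nilpotent.
Variable S : semigroup0Type.
Implicit Types x y w z : S.

Lemma iter_mull_sexp x w n : (0 < n)%N -> iter n ( *%g x) w = sexp x n * w.
Proof.
case: n => // n _; elim: n => //= n IHn.
by rewrite /= in IHn; rewrite IHn mulgA.
Qed.

Lemma iter_mulr_sexp x w n :
  (0 < n)%N -> iter n ( *%g^~ x) w = w * sexp x n.
Proof.
case: n => // n _; elim: n w => // n IHn w.
by rewrite iterSr IHn -mulgA.
Qed.

Lemma nilpotent_last_mull x w : nilpotents S x -> w != szero ->
  exists2 i, iter i ( *%g x) w != szero & x * iter i ( *%g x) w = szero.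
Proof.
case=> n n_gt0 xn0 w0; apply: (@iter_last_neq _ _ w szero n) => //.
by rewrite iter_mull_sexp // xn0 smul0s.
Qed.

Lemma nilpotent_last_mulr x w : nilpotents S x -> w != szero ->
  exists2 i, iter i ( *%g^~ x) w != szero & iter i ( *%g^~ x) w * x = szero.
Proof.
case=> n n_gt0 xn0 w0; apply: (@iter_last_neq _ ( *%g^~ x) w szero n) => //.
by rewrite iter_mulr_sexp // xn0 smuls0.
Qed.

(** A vertex between [x] and [y].  The two multiplications do not disturb each
    other: by associativity, right factors [y] preserve [x * w = szero]. *)
Lemma nilpotent_common_annihilator x y :
    nilpotents S x -> nilpotents S y -> y != szero ->
  exists z, [/\ z != szero, x * z = szero & z * y = szero].
Proof.
move=> x_nil y_nil y0.
have [i w0 xw0] := nilpotent_last_mull x_nil y0.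
have [j z0 zy0] := nilpotent_last_mulr y_nil w0.
exists (iter j ( *%g^~ y) (iter i ( *%g x) y)); split=> //.
by elim: j {z0 zy0} => //= j IHj; rewrite mulgA IHj smul0s.
Qed.

Lemma mul0_zd_arc x y : x != szero -> y != szero -> x != y -> x * y = szero ->
  zd_arc x y.
Proof.
move=> x0 y0 xy xy0; rewrite /zd_arc xy xy0 eqxx !andbT.
apply/andP; split; apply/mem_set; split; try exact/eqP.
  by left; exists y.
by right; exists x.
Qed.

End Nilpotent.

Theorem theorem3p1 (S : semigroup0Type) (x y : S)
    (hx : (nilpotents S `\ szero)%classic x) (hy : (nilpotents S `\ szero)%classic y)
    (hxy : x <> y) :
  (ddist (zero_divisor_digraph S) x y <= 2%:E)%E.
Proof.
case: hx hy => x_nil /eqP x0 [y_nil /eqP y0]; have /eqP xy := hxy.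
have dist1 : x * y = szero -> (ddist (zero_divisor_digraph S) x y <= 2%:E)%E.
  move=> /(mul0_zd_arc x0 y0 xy) x_to_y.
  have xy_path : is_dipath (zero_divisor_digraph S) x y [:: y].
    split=> //=; first exact: (zd_arc_vertices x_to_y).1.
      by rewrite x_to_y.
    by rewrite inE xy.
  by apply: Order.POrderTheory.le_trans (ddist_le_size xy_path) _.
have [z [z0 xz0 zy0]] := nilpotent_common_annihilator x_nil y_nil y0.
have [zx|zx] := eqVneq z x; first by apply: dist1; rewrite -{1}zx.
have [zy|zy] := eqVneq z y; first by apply: dist1; rewrite -zy.
rewrite eq_sym in zx.
have x_to_z := mul0_zd_arc x0 z0 zx xz0; have z_to_y := mul0_zd_arc z0 y0 zy zy0.
apply: (@ddist_le_size _ _ _ _ [:: z; y]); split=> //=.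
- exact: (zd_arc_vertices x_to_z).1.
- by rewrite x_to_z z_to_y.
- by rewrite !inE negb_or zx xy zy.
Qed.
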